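(* If $m$ is a non-negative integer, then \[ \sum_{n=1}^\infty\frac{2^{2n}}{n(n+1)\binom{2(n+m)}{n+m}\binom{n+m}{m}}=\frac{1}{\binom{2m}{m}}\left(\left(m-\frac12\right)\left(4O_m^{(2)}-3\zeta(2)\right)+1\right). \] In particular, \[ \sum_{n=1}^\infty\frac{2^{2n}}{n(n+1)\binom{2n}{n}}=\frac{\pi^2}{4}+1,\quad \sum_{n=1}^\infty\frac{2^{2n}}{n(n+1)^2\binom{2(n+1)}{n+1}}=\frac32-\frac{\pi^2}{8},\quad \sum_{n=1}^\infty\frac{2^{2n}}{n(n+1)^2(n+2)\binom{2(n+2)}{n+2}}=\frac{23}{36}-\frac{\pi^2}{16}. \]
   Context: $\zeta$ is the Riemann zeta function. For nonnegative integer $m$, $O_m^{(2)}=\sum_{j=1}^m (2j-1)^{-2}$ (empty sum $=0$). *)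

(* Defs.v *)
From Stdlib Require Import Reals.
From Coquelicot Require Import Coquelicot.
Open Scope R_scope.

(* sum_{n >= 1} a n converges with sum l; the value a 0 is irrelevant. *)
Definition is_series_from1 (a : nat -> R) (l : R) : Prop :=
  is_series (fun k : nat => a (S k)) l.

(* The Dirichlet series sum_{n >= 1} n^(-s) defining the Riemann zeta function
   for real s > 1; values at s <= 1 are not the analytic continuation. *)
Definition zeta (s : R) : R :=
  Series (fun k : nat => Rpower (INR (S k)) (- s)).

(* Real-valued binomial coefficient, meaningful for k <= n; the qualified name
   avoids Coquelicot's type C of complex numbers. *)
Definition binom (n k : nat) : R := Binomial.C n k.

(* Coquelicot's [sum_n_m a 1 0] is the empty sum, so O2 0 = 0. *)
Definition O2 (m : nat) : R :=
  sum_n_m (fun j : nat => / (2 * INR j - 1) ^ 2) 1 m.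

(* Main.v *)
(* Let t(n, m) be binom(2m, m) times the n-th summand.  It decreases in m, and a
   WZ pair in (n, m) evaluates sum_n t(n, m + 1) against sum_n t(n, m): the
   normalisation T(m) = (sum_n t(n, m) - 1) / (m - 1/2) satisfies
   T(m + 1) - T(m) = 4 / (2 m + 1)^2.  Since the sums are bounded in m, T tends
   to 0, so T(0) = - 4 sum_j (2 j - 1)^(-2) = - 3 zeta(2).
   The value of zeta(2) comes from iterating the duplication formula
   4 / sin^2 x = 1 / sin^2 (x/2) + 1 / sin^2 (pi/2 - x/2) from x = pi/4, which
   gives the sum of 1 / sin^2 over the odd multiples of pi / 2^(n + 2) below pi/2,
   together with 1 / sin^2 x - 1 <= 1 / x^2 <= 1 / sin^2 x. *)
Require Import Defs.
From Stdlib Require Import Reals Factorial Lra Lia.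
From Coquelicot Require Import Coquelicot.
Open Scope R_scope.

(** * Odd inverse squares and their relation to zeta(2) *)

Lemma O2_0 : O2 0 = 0.
Proof. unfold O2; rewrite sum_n_m_zero by lia; reflexivity. Qed.

Lemma O2_S (m : nat) : O2 (S m) = O2 m + / (2 * INR m + 1) ^ 2.
Proof.
  unfold O2; rewrite sum_n_Sm by lia.
  replace (2 * INR (S m) - 1) with (2 * INR m + 1) by (rewrite S_INR; ring).
  reflexivity.
Qed.

Definition inv_squares (n : nat) : R := sum_n (fun k => / INR (S k) ^ 2) n.

Lemma inv_squares_S (n : nat) :
  inv_squares (S n) = inv_squares n + / INR (S (S n)) ^ 2.
Proof. unfold inv_squares; rewrite sum_Sn; reflexivity. Qed.

(** The telescoping majorant 1/(x + 1)^2 <= 1/x - 1/(x + 1) drives the induction; the subtracted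
    term is what makes the step close. *)
Lemma inv_squares_bound (n : nat) : inv_squares n <= 2 - / INR (S n).
Proof.
  induction n as [|n IH].
  - unfold inv_squares; rewrite sum_O; simpl; lra.
  - rewrite inv_squares_S.
    apply Rle_trans with (2 - / INR (S n) + / INR (S (S n)) ^ 2); [lra|].
    rewrite (S_INR (S n)).
    assert (0 < INR (S n)) by (apply lt_0_INR; lia).
    set (x := INR (S n)) in *.
    apply Rminus_le.
    replace (2 - / x + / (x + 1) ^ 2 - (2 - / (x + 1)))
      with (- / (x * (x + 1) ^ 2)) by (field; lra).
    assert (0 < / (x * (x + 1) ^ 2)) by (apply Rinv_0_lt_compat; nra).
    lra.
Qed.

Lemma inv_squares_zeta_2 : is_lim_seq inv_squares (zeta 2).
Proof.
  assert (E : ex_finite_lim_seq inv_squares).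
  { apply ex_finite_lim_seq_incr with 2.
    - intros n; rewrite inv_squares_S.
      assert (0 < / INR (S (S n)) ^ 2); [|lra].
      apply Rinv_0_lt_compat, pow_lt, lt_0_INR; lia.
    - intros n; pose proof (inv_squares_bound n).
      assert (0 < / INR (S n)) by (apply Rinv_0_lt_compat, lt_0_INR; lia).
      lra. }
  destruct E as [l Hl].
  replace (zeta 2) with l; [exact Hl|].
  symmetry; apply is_series_unique.
  apply is_series_ext with (fun k => / INR (S k) ^ 2); [|exact Hl].
  intros k; rewrite Rpower_Ropp.
  replace (Rpower (INR (S k)) 2) with (Rpower (INR (S k)) (INR 2)) by reflexivity.
  rewrite Rpower_pow; [reflexivity | apply lt_0_INR; lia].
Qed.

(** Separates odd from even bases. As [inv_squares n] has n + 1 terms, the left side has 2n + 2,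
    half of each parity. *)
Lemma inv_squares_split (n : nat) :
  inv_squares (2 * n + 1) = O2 (S n) + / 4 * inv_squares n.
Proof.
  induction n as [|n IH].
  - simpl (2 * 0 + 1)%nat; rewrite inv_squares_S, O2_S.
    rewrite O2_0; unfold inv_squares; rewrite sum_O; simpl; field.
  - replace (2 * S n + 1)%nat with (S (S (2 * n + 1))) by lia.
    rewrite !inv_squares_S, IH, (O2_S (S n)).
    rewrite !S_INR, plus_INR, mult_INR; simpl (INR 2); simpl (INR 1).
    pose proof (pos_INR n); field; lra.
Qed.

Lemma O2_lim_zeta_2 : is_lim_seq O2 (3 / 4 * zeta 2).
Proof.
  apply is_lim_seq_incr_1.
  apply is_lim_seq_ext with
    (fun n => inv_squares (2 * n + 1) - / 4 * inv_squares n).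
  { intros n; rewrite inv_squares_split; ring. }
  replace (3 / 4 * zeta 2) with (zeta 2 - / 4 * zeta 2) by field.
  apply is_lim_seq_minus'.
  - apply (is_lim_seq_subseq inv_squares _ (fun n => (2 * n + 1)%nat)).
    + apply eventually_subseq; intros n; lia.
    + apply inv_squares_zeta_2.
  - apply (is_lim_seq_scal_l _ (/ 4) (zeta 2)), inv_squares_zeta_2.
Qed.

(** * Evaluation of zeta(2) by sums of inverse squared sines *)

Lemma inv_sin_sqr_half (x : R) : 0 < x < PI ->
  / sin (x / 2) ^ 2 + / sin (PI / 2 - x / 2) ^ 2 = 4 * / sin x ^ 2.
Proof.
  intros Hx.
  rewrite sin_shift.
  replace (sin x) with (2 * sin (x / 2) * cos (x / 2))
    by (rewrite <- sin_2a; f_equal; field).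
  assert (0 < sin (x / 2)) by (apply sin_gt_0; lra).
  assert (0 < cos (x / 2)) by (apply cos_gt_0; lra).
  pose proof (sin2_cos2 (x / 2)) as E; unfold Rsqr in E.
  transitivity ((sin (x / 2) * sin (x / 2) + cos (x / 2) * cos (x / 2))
                / (sin (x / 2) * cos (x / 2)) ^ 2).
  - field; lra.
  - rewrite E; field; lra.
Qed.

(** The difference vanishes at 0 and has derivative t sin t > 0; this is x < tan x without
    division. *)
Lemma x_cos_lt_sin (x : R) : 0 < x < PI / 2 -> x * cos x < sin x.
Proof.
  intros Hx.
  destruct (MVT_cor2 (fun t => sin t - t * cos t) (fun t => t * sin t) 0 x)
    as [c [Ec Hc]].
  - lra.
  - intros c _; apply is_derive_Reals; auto_derive; [trivial | ring].
  - assert (0 < sin c) by (apply sin_gt_0; lra).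
    rewrite sin_0 in Ec.
    assert (0 < c * sin c * (x - 0)) by (repeat apply Rmult_lt_0_compat; lra).
    lra.
Qed.

(** Squared reciprocals of sin x < x < tan x: the left side is cot^2 x. *)
Lemma inv_sqr_sandwich (x : R) : 0 < x < PI / 2 ->
  / sin x ^ 2 - 1 <= / x ^ 2 <= / sin x ^ 2.
Proof.
  intros Hx.
  assert (Hs : 0 < sin x) by (apply sin_gt_0; lra).
  assert (Hc : 0 < cos x) by (apply cos_gt_0; lra).
  pose proof (sin_lt_x x (proj1 Hx)).
  pose proof (x_cos_lt_sin x Hx).
  split.
  - pose proof (sin2_cos2 x) as E; unfold Rsqr in E.
    replace (/ sin x ^ 2 - 1) with (cos x ^ 2 / sin x ^ 2)
      by (replace (cos x ^ 2) with (1 - sin x ^ 2) by lra; field; lra).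
    apply <- Rle_div_l; [|apply pow_lt; lra].
    replace (/ x ^ 2 * sin x ^ 2) with (sin x ^ 2 / x ^ 2) by (field; lra).
    apply -> Rle_div_r; [|apply pow_lt; lra].
    rewrite <- Rpow_mult_distr; apply pow_incr; nra.
  - apply Rinv_le_contravar; [apply pow_lt; lra | apply pow_incr; lra].
Qed.

(** Pairs each index with its mirror image, so that the duplication formula applies pair by pair. *)
Lemma sum_f_R0_fold (f : nat -> R) (p : nat) :
  sum_f_R0 f (2 * p + 1)
  = sum_f_R0 (fun k => f k + f (2 * p + 1 - k)%nat) p.
Proof.
  rewrite (tech2 f p) by lia.
  replace (2 * p + 1 - S p)%nat with p by lia.
  rewrite sum_plus; f_equal.
  rewrite <- sum_f_R0_skip.
  apply sum_eq; intros k Hk; f_equal; lia.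
Qed.

(** For k < 2^n these are the odd multiples of pi / 2^(n + 2) in (0, pi/2); raising n by one halves
    the angle of fixed k. *)
Definition odd_angle (n k : nat) : R := (2 * INR k + 1) * PI / 2 ^ (n + 2).

Lemma odd_angle_bound (n k : nat) :
  (k <= pred (2 ^ n))%nat -> 0 < odd_angle n k < PI / 2.
Proof.
  intros Hk; unfold odd_angle.
  pose proof PI_RGT_0; pose proof (pos_INR k).
  assert (Hn : INR (S k) <= 2 ^ n).
  { replace (2 ^ n) with (INR (2 ^ n)) by (rewrite pow_INR; reflexivity).
    apply le_INR; pose proof (Nat.pow_nonzero 2 n); lia. }
  rewrite S_INR in Hn.
  rewrite pow_add; replace (2 ^ 2) with 4 by ring.
  split.
  - apply Rdiv_lt_0_compat; nra.
  - apply <- Rlt_div_l; nra.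
Qed.

(** The base case is 1 / sin^2(pi/4) = 2. Folding level n + 1 gives one mirrored pair per angle of
    level n, and each pair contributes 4 times the term of that angle. *)
Lemma sum_inv_sin_sqr (n : nat) :
  sum_f_R0 (fun k => / sin (odd_angle n k) ^ 2) (pred (2 ^ n)) = 2 * 4 ^ n.
Proof.
  induction n as [|n IH].
  - unfold odd_angle; cbn [sum_f_R0 Nat.pred Nat.pow INR Nat.add].
    replace ((2 * 0 + 1) * PI / 2 ^ 2) with (PI / 4) by field.
    rewrite sin_PI4.
    pose proof (sqrt_lt_R0 2).
    replace ((1 / sqrt 2) ^ 2) with (/ (sqrt 2 * sqrt 2)) by (field; lra).
    rewrite sqrt_sqrt by lra; field.
  - pose proof (Nat.pow_nonzero 2 n) as Hn.
    replace (pred (2 ^ S n)) with (2 * pred (2 ^ n) + 1)%nat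
      by (rewrite Nat.pow_succ_r'; lia).
    rewrite sum_f_R0_fold.
    replace (2 * 4 ^ S n) with (4 * (2 * 4 ^ n)) by (simpl; ring).
    rewrite <- IH, scal_sum.
    apply sum_eq; intros k Hk.
    pose proof (odd_angle_bound n k Hk).
    rewrite Rmult_comm, <- inv_sin_sqr_half by lra.
    assert (H2 : 0 < 2 ^ n) by (apply pow_lt; lra).
    (* The angle of index k at level n + 1 is x/2, where x is the one at level n; its mirror index
       gives pi/2 - x/2. *)
    f_equal; do 3 f_equal; unfold odd_angle.
    + simpl (S n + 2)%nat; rewrite <- tech_pow_Rmult; field.
      apply pow_nonzero; lra.
    + rewrite minus_INR, plus_INR, mult_INR by lia.
      replace (pred (2 ^ n)) with (2 ^ n - 1)%nat by lia.
      rewrite minus_INR, pow_INR by lia; simpl (INR 2); simpl (INR 1).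
      simpl (S n + 2)%nat; rewrite <- tech_pow_Rmult, !pow_add.
      replace (1 + 1) with 2 by ring; field; lra.
Qed.

Lemma O2_sum_inv_angle_sqr (n : nat) :
  O2 (2 ^ n)
  = PI ^ 2 / (16 * 4 ^ n)
    * sum_f_R0 (fun k => / odd_angle n k ^ 2) (pred (2 ^ n)).
Proof.
  assert (E : forall p, O2 (S p) = sum_f_R0 (fun k => / (2 * INR k + 1) ^ 2) p).
  { induction p as [|p IH]; rewrite O2_S; [|rewrite IH; reflexivity].
    rewrite O2_0; apply Rplus_0_l. }
  replace (O2 (2 ^ n)) with (O2 (S (pred (2 ^ n))))
    by (f_equal; pose proof (Nat.pow_nonzero 2 n); lia).
  rewrite E, scal_sum.
  apply sum_eq; intros k _; unfold odd_angle.
  pose proof PI_RGT_0; pose proof (pos_INR k).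
  assert (0 < 2 ^ n) by (apply pow_lt; lra).
  replace (4 ^ n) with (2 ^ n * 2 ^ n)
    by (rewrite <- Rpow_mult_distr; f_equal; ring).
  rewrite pow_add; field; lra.
Qed.

Lemma O2_pow_2_bound (n : nat) :
  PI ^ 2 / 8 - PI ^ 2 / 16 * (/ 2) ^ n <= O2 (2 ^ n) <= PI ^ 2 / 8.
Proof.
  assert (H2 : 0 < 2 ^ n) by (apply pow_lt; lra).
  assert (E4 : 4 ^ n = 2 ^ n * 2 ^ n)
    by (rewrite <- Rpow_mult_distr; f_equal; ring).
  assert (Hc : 0 <= PI ^ 2 / (16 * 4 ^ n)).
  { apply Rlt_le, Rdiv_lt_0_compat; [apply pow_lt, PI_RGT_0 | nra]. }
  pose proof (sum_inv_sin_sqr n) as E.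
  (* The sandwich loses at most 1 on each of the 2^n angles; scaling by pi^2 / (16 * 4^n) turns this
     loss into pi^2/16 * 2^(-n). *)
  assert (Hsum : 2 * 4 ^ n - 2 ^ n
    <= sum_f_R0 (fun k => / odd_angle n k ^ 2) (pred (2 ^ n)) <= 2 * 4 ^ n).
  { rewrite <- E; split.
    - replace (2 ^ n) with (sum_f_R0 (fun _ => 1) (pred (2 ^ n))).
      + rewrite <- minus_sum; apply sum_Rle; intros k Hk.
        apply inv_sqr_sandwich, odd_angle_bound, Hk.
      + rewrite sum_cte, Nat.succ_pred by (apply Nat.pow_nonzero; lia).
        rewrite pow_INR, Rmult_1_l; reflexivity.
    - apply sum_Rle; intros k Hk.
      apply inv_sqr_sandwich, odd_angle_bound, Hk. }
  rewrite O2_sum_inv_angle_sqr, pow_inv.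
  replace (PI ^ 2 / 8 - PI ^ 2 / 16 * / 2 ^ n)
    with (PI ^ 2 / (16 * 4 ^ n) * (2 * 4 ^ n - 2 ^ n))
    by (rewrite E4; field; lra).
  replace (PI ^ 2 / 8) with (PI ^ 2 / (16 * 4 ^ n) * (2 * 4 ^ n))
    by (rewrite E4; field; lra).
  split; apply Rmult_le_compat_l; tauto.
Qed.

(** Compares two limits of [O2] along powers of two: 3/4 zeta(2) and pi^2/8. *)
Lemma zeta_2 : zeta 2 = PI ^ 2 / 6.
Proof.
  assert (L1 : is_lim_seq (fun n => O2 (2 ^ n)) (3 / 4 * zeta 2)).
  { apply (is_lim_seq_subseq O2 _ (fun n => (2 ^ n)%nat)), O2_lim_zeta_2.
    apply eventually_subseq; intros n; apply Nat.pow_lt_mono_r; lia. }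
  assert (L2 : is_lim_seq (fun n => O2 (2 ^ n)) (PI ^ 2 / 8)).
  { apply is_lim_seq_le_le with (1 := O2_pow_2_bound); [|apply is_lim_seq_const].
    replace (Finite (PI ^ 2 / 8)) with (Finite (PI ^ 2 / 8 - PI ^ 2 / 16 * 0))
      by (f_equal; ring).
    apply is_lim_seq_minus'; [apply is_lim_seq_const|].
    apply (is_lim_seq_scal_l _ _ 0), is_lim_seq_geom.
    rewrite Rabs_pos_eq; lra. }
  apply is_lim_seq_unique in L1, L2.
  assert (E : Finite (3 / 4 * zeta 2) = Finite (PI ^ 2 / 8)) by congruence.
  injection E; lra.
Qed.

(** * The scaled summand: ratios in both indices and decay *)

(* The summand of index n = S k, times binom (2 * m) m. *)
Definition scaled_term (k m : nat) : R :=
  binom (2 * m) m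
  * (2 ^ (2 * S k)
     / (INR (S k) * INR (S k + 1) * binom (2 * (S k + m)) (S k + m)
        * binom (S k + m) m)).

(** After cancellation only factorials and a power remain, so a shift of either index multiplies the
    term by a rational function. *)
Lemma scaled_term_fact (k m : nat) :
  scaled_term k m =
  INR (fact (2 * m)) * INR (fact (S k + m)) * INR (fact (S k)) * 4 ^ S k
  / (INR (fact m) * INR (fact (2 * (S k + m))) * INR (S k) * INR (S k + 1)).
Proof.
  unfold scaled_term, binom, Binomial.C.
  replace (2 * m - m)%nat with m by lia.
  replace (2 * (S k + m) - (S k + m))%nat with (S k + m)%nat by lia.
  replace (S k + m - m)%nat with (S k) by lia.
  rewrite pow_mult; replace (2 ^ 2) with 4 by ring.
  field; repeat split;
    first [ apply INR_fact_neq_0 | apply not_0_INR; lia | apply pow_nonzero; lra ].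
Qed.

Lemma scaled_term_pos (k m : nat) : 0 < scaled_term k m.
Proof.
  rewrite scaled_term_fact.
  apply Rdiv_lt_0_compat; repeat apply Rmult_lt_0_compat;
    first [ apply INR_fact_lt_0 | apply lt_0_INR; lia | apply pow_lt; lra | lra ].
Qed.

Lemma fact_double_S (p : nat) :
  INR (fact (2 * S p))
  = (2 * INR p + 2) * (2 * INR p + 1) * INR (fact (2 * p)).
Proof.
  replace (2 * S p)%nat with (S (S (2 * p))) by lia.
  rewrite 2!fact_simpl, 2!mult_INR, !S_INR, mult_INR; simpl (INR 2); ring.
Qed.

Lemma scaled_term_S_r (k m : nat) :
  scaled_term k (S m)
  = scaled_term k m * (2 * INR m + 1) / (2 * INR k + 2 * INR m + 3).
Proof.
  rewrite !scaled_term_fact.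
  replace (S k + S m)%nat with (S (S k + m)) by lia.
  rewrite !fact_double_S, (fact_simpl (S k + m)), (fact_simpl m), !mult_INR.
  rewrite (S_INR (S k + m)), !plus_INR, !S_INR; simpl (INR 0).
  pose proof (pos_INR k); pose proof (pos_INR m).
  field; repeat split; first [ apply INR_fact_neq_0 | lra ].
Qed.

Lemma scaled_term_S_l (k m : nat) :
  scaled_term (S k) m
  = scaled_term k m * (2 * (INR k + 1) * (INR k + 2))
    / ((INR k + 3) * (2 * INR k + 2 * INR m + 3)).
Proof.
  rewrite !scaled_term_fact.
  replace (S (S k) + m)%nat with (S (S k + m)) by lia.
  rewrite fact_double_S, (fact_simpl (S k + m)), (fact_simpl (S k)), !mult_INR.
  rewrite (S_INR (S k + m)), !plus_INR, !S_INR; simpl (INR 0).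
  rewrite <- !tech_pow_Rmult.
  pose proof (pos_INR k); pose proof (pos_INR m).
  field; repeat split; first [ apply INR_fact_neq_0 | lra ].
Qed.

Lemma scaled_term_0_l (m : nat) : scaled_term 0 m = / (2 * INR m + 1).
Proof.
  rewrite scaled_term_fact.
  replace (1 + m)%nat with (S m) by lia.
  rewrite fact_double_S, (fact_simpl m), mult_INR, S_INR; simpl.
  pose proof (pos_INR m).
  field; repeat split; first [ apply INR_fact_neq_0 | lra ].
Qed.

Lemma scaled_term_decr (k m : nat) : scaled_term k (S m) <= scaled_term k m.
Proof.
  rewrite scaled_term_S_r.
  pose proof (pos_INR k); pose proof (pos_INR m).
  pose proof (scaled_term_pos k m).
  apply <- Rle_div_l; nra.
Qed.

Lemma scaled_term_le_0_r (k m : nat) : scaled_term k m <= scaled_term k 0.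
Proof.
  induction m as [|m IH]; [lra|].
  apply Rle_trans with (2 := IH), scaled_term_decr.
Qed.

(** The left side equals 4 at k = 0 and decreases: its successive ratio is 4(x + 1)(x + 2) / (2x +
    3)^2 < 1. Hence [scaled_term k 0] is O(k^(-3/2)), with no appeal to Stirling's formula. *)
Lemma scaled_term_0_r_sqr_bound (k : nat) :
  (INR k + 1) * ((INR k + 2) * scaled_term k 0) ^ 2 <= 4.
Proof.
  induction k as [|k IH].
  - rewrite scaled_term_0_l; simpl; lra.
  - apply Rle_trans with (2 := IH).
    rewrite scaled_term_S_l, S_INR; simpl (INR 0).
    pose proof (pos_INR k); pose proof (scaled_term_pos k 0).
    set (x := INR k) in *; set (t := scaled_term k 0) in *.
    replace ((x + 1 + 1) *
       ((x + 1 + 2) * (t * (2 * (x + 1) * (x + 2)) / ((x + 3) * (2 * x + 2 * 0 + 3)))) ^ 2)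
      with ((x + 1) * ((x + 2) * t) ^ 2
            * (4 * (x + 1) * (x + 2) / (2 * x + 3) ^ 2)) by (field; lra).
    rewrite <- (Rmult_1_r ((x + 1) * _)) at 2.
    apply Rmult_le_compat_l; [nra|].
    apply <- Rle_div_l; nra.
Qed.

(** Monotonicity in m reduces to m = 0, where the squared bound gives at most 2 / sqrt(k + 1). This
    kills the boundary term of the telescoping sum. *)
Lemma scaled_term_lim_0 (m : nat) :
  is_lim_seq (fun k => (INR k + 2) * scaled_term k m) 0.
Proof.
  apply is_lim_seq_le_le with (u := fun _ => 0) (w := fun k => sqrt (4 / (INR k + 1))).
  - intros k.
    pose proof (pos_INR k); pose proof (scaled_term_pos k m).
    split; [nra|].
    pose proof (scaled_term_le_0_r k m).
    pose proof (scaled_term_0_r_sqr_bound k).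
    apply Rle_trans with ((INR k + 2) * scaled_term k 0); [nra|].
    rewrite <- (sqrt_pow2 ((INR k + 2) * scaled_term k 0)) by nra.
    apply sqrt_le_1_alt; apply -> Rle_div_r; lra.
  - apply is_lim_seq_const.
  - rewrite <- sqrt_0.
    apply is_lim_seq_continuous; [apply continuity_pt_sqrt; lra|].
    replace (Finite 0) with (Rbar_mult 4 0) by (simpl; f_equal; ring).
    apply is_lim_seq_scal_l.
    apply is_lim_seq_ext with (fun k => / INR (S k)).
    { intros k; rewrite S_INR; reflexivity. }
    replace (Finite 0) with (Rbar_inv p_infty) by reflexivity.
    apply is_lim_seq_inv; [|discriminate].
    apply -> is_lim_seq_incr_1; apply is_lim_seq_INR.
Qed.

(** * Telescoping in k and convergence *)

(* Up to the factor [- 4 / (2 * INR m - 1)] the summand is the difference of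
   [scaled_term k m / (INR m - 1 / 2)] in m. *)
Lemma telescoped_series (m : nat) :
  is_series
    (fun k => scaled_term k m * (INR k + 2) / (2 * INR k + 2 * INR m + 3))
    (2 / (2 * INR m + 1) ^ 2).
Proof.
  pose proof (pos_INR m) as Hm.
  enough (L : is_lim_seq (sum_n
    (fun k => scaled_term k m * (INR k + 2) / (2 * INR k + 2 * INR m + 3)))
    (2 / (2 * INR m + 1) ^ 2)) by exact L.
  (* The summand is G(k) - G(k + 1) for the WZ mate G(k) = (k + 2) t(k, m) / (2m + 1), t being
     [scaled_term]; the partial sum is G(0) - G(n + 1), and t(0, m) = 1 / (2m + 1) gives G(0). *)
  apply is_lim_seq_ext with
    (fun n => 2 / (2 * INR m + 1) ^ 2
              - / (2 * INR m + 1) * ((INR (S n) + 2) * scaled_term (S n) m)).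
  - induction n as [|n IH].
    + rewrite sum_O, scaled_term_S_l, scaled_term_0_l; simpl; field; lra.
    + rewrite sum_Sn, <- IH; change plus with Rplus.
      rewrite (scaled_term_S_l (S n)), !S_INR.
      pose proof (pos_INR n); field; lra.
  - replace (2 / (2 * INR m + 1) ^ 2)
      with (2 / (2 * INR m + 1) ^ 2 - / (2 * INR m + 1) * 0) at 1 by ring.
    apply is_lim_seq_minus'; [apply is_lim_seq_const|].
    apply (is_lim_seq_scal_l _ _ 0).
    apply -> (is_lim_seq_incr_1 (fun n => (INR n + 2) * scaled_term n m)).
    apply scaled_term_lim_0.
Qed.

Lemma ex_series_scaled_term (m : nat) :
  ex_series (fun k => scaled_term k m).
Proof.
  pose proof (pos_INR m) as Hm.
  (* Comparison with the telescoped series, since 2k + 2m + 3 <= (2m + 2)(k + 2). *)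
  apply (ex_series_le (K := R_AbsRing) (V := R_CompleteNormedModule)) with
    (fun k => (2 * INR m + 2)
       * (scaled_term k m * (INR k + 2) / (2 * INR k + 2 * INR m + 3))).
  - intros k; unfold norm; simpl; unfold abs; simpl.
    pose proof (pos_INR k); pose proof (scaled_term_pos k m) as Ht.
    rewrite Rabs_pos_eq by lra.
    replace ((2 * INR m + 2) * (scaled_term k m * (INR k + 2) / (2 * INR k + 2 * INR m + 3)))
      with (scaled_term k m * (2 * INR m + 2) * (INR k + 2) / (2 * INR k + 2 * INR m + 3))
      by (field; lra).
    apply -> Rle_div_r; [|lra].
    rewrite Rmult_assoc; apply Rmult_le_compat_l; nra.
  - apply (ex_series_scal_l (2 * INR m + 2)
      (fun k => scaled_term k m * (INR k + 2) / (2 * INR k + 2 * INR m + 3))).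
    eexists; apply telescoped_series.
Qed.

(** * Recurrence in m and closed form of the sum *)

Definition scaled_sum (m : nat) : R := Series (fun k => scaled_term k m).

(** A parity argument, because 2m - 1 changes sign between m = 0 and m = 1. *)
Lemma double_minus_1_neq_0 (m : nat) : 2 * INR m - 1 <> 0.
Proof.
  intros H; apply (Nat.Even_Odd_False (2 * m)); [exists m; lia|].
  exists 0%nat; apply INR_eq; rewrite mult_INR; simpl (INR 2); simpl; lra.
Qed.

Lemma scaled_sum_S (m : nat) :
  (scaled_sum (S m) - 1) / (INR (S m) - 1 / 2)
  - (scaled_sum m - 1) / (INR m - 1 / 2)
  = 4 / (2 * INR m + 1) ^ 2.
Proof.
  pose proof (double_minus_1_neq_0 m) as H2.
  pose proof (pos_INR m) as Hm.
  (* Termwise, t(k, m + 1) - (2m + 1)/(2m - 1) t(k, m) is the constant -2(2m + 1)/(2m - 1) times the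
     telescoped summand. Subtracting 1 from the sums then cancels the remaining factor 2m - 1. *)
  assert (H : scaled_sum (S m) - (2 * INR m + 1) / (2 * INR m - 1) * scaled_sum m
              = - (2 * (2 * INR m + 1) / (2 * INR m - 1)) * (2 / (2 * INR m + 1) ^ 2)).
  { unfold scaled_sum.
    rewrite <- (is_series_unique _ _ (telescoped_series m)).
    rewrite <- !Series_scal_l, <- Series_minus.
    - apply Series_ext; intros k; rewrite scaled_term_S_r.
      pose proof (pos_INR k); field; lra.
    - apply ex_series_scaled_term.
    - apply (ex_series_scal_l ((2 * INR m + 1) / (2 * INR m - 1))
               (fun k => scaled_term k m)), ex_series_scaled_term. }
  rewrite S_INR.
  replace (scaled_sum (S m)) with
    ((2 * INR m + 1) / (2 * INR m - 1) * scaled_sum m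
     - (2 * (2 * INR m + 1) / (2 * INR m - 1)) * (2 / (2 * INR m + 1) ^ 2)) by lra.
  field; lra.
Qed.

(** Sums the recurrence from its value at m = 0, where the denominator is -1/2. *)
Lemma scaled_sum_O2 (m : nat) :
  (scaled_sum m - 1) / (INR m - 1 / 2) = 2 - 2 * scaled_sum 0 + 4 * O2 m.
Proof.
  induction m as [|m IH].
  - rewrite O2_0; simpl; field.
  - pose proof (scaled_sum_S m) as H; rewrite IH in H; rewrite O2_S.
    unfold Rdiv in *; lra.
Qed.

Lemma scaled_sum_bound (m : nat) : 0 <= scaled_sum m <= scaled_sum 0.
Proof.
  split.
  - unfold scaled_sum.
    rewrite <- (Rmult_0_l (Series (fun k => scaled_term k m))), <- Series_scal_l.
    apply Series_le; [|apply ex_series_scaled_term].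
    intros k; pose proof (scaled_term_pos k m); lra.
  - apply Series_le; [|apply ex_series_scaled_term].
    intros k; pose proof (scaled_term_pos k m).
    pose proof (scaled_term_le_0_r k m); lra.
Qed.

Lemma O2_lim_scaled_sum : is_lim_seq O2 ((scaled_sum 0 - 1) / 2).
Proof.
  assert (L : is_lim_seq (fun m => (scaled_sum m - 1) / (INR m - 1 / 2)) 0).
  { assert (I : is_lim_seq (fun m => / (INR m - 1 / 2)) 0).
    { replace (Finite 0) with (Rbar_inv p_infty) by reflexivity.
      apply is_lim_seq_inv; [|discriminate].
      apply is_lim_seq_minus with p_infty (1 / 2);
        [apply is_lim_seq_INR | apply is_lim_seq_const | reflexivity]. }
    (* The shift drops m = 0, the only index at which m - 1/2 is negative. *)
    apply (is_lim_seq_incr_1 (fun m => (scaled_sum m - 1) / (INR m - 1 / 2))).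
    apply is_lim_seq_incr_1 in I.
    (* B bounds |[scaled_sum m] - 1| for every m. *)
    set (B := scaled_sum 0 + 1).
    apply is_lim_seq_le_le with
      (u := fun m => - B * / (INR (S m) - 1 / 2))
      (w := fun m => B * / (INR (S m) - 1 / 2)).
    - intros m; rewrite S_INR.
      pose proof (pos_INR m); pose proof (scaled_sum_bound (S m)).
      assert (0 < / (INR m + 1 - 1 / 2)) by (apply Rinv_0_lt_compat; lra).
      unfold B, Rdiv; split; apply Rmult_le_compat_r; lra.
    - replace (Finite 0) with (Rbar_mult (- B) 0) by (simpl; f_equal; ring).
      apply is_lim_seq_scal_l, I.
    - replace (Finite 0) with (Rbar_mult B 0) by (simpl; f_equal; ring).
      apply is_lim_seq_scal_l, I. }
  apply is_lim_seq_ext with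
    (fun m => / 4 * ((scaled_sum m - 1) / (INR m - 1 / 2)) + (scaled_sum 0 - 1) / 2).
  { intros m; rewrite scaled_sum_O2; field. }
  replace (Finite ((scaled_sum 0 - 1) / 2))
    with (Finite (/ 4 * 0 + (scaled_sum 0 - 1) / 2)) by (f_equal; ring).
  apply is_lim_seq_plus'; [|apply is_lim_seq_const].
  apply (is_lim_seq_scal_l _ (/ 4) 0 L).
Qed.

(** The two limits found for [O2] must agree, which fixes [scaled_sum 0] in terms of zeta(2). *)
Lemma scaled_sum_eq (m : nat) :
  scaled_sum m = (INR m - 1 / 2) * (4 * O2 m - 3 * zeta 2) + 1.
Proof.
  assert (E : Finite ((scaled_sum 0 - 1) / 2) = Finite (3 / 4 * zeta 2)).
  { pose proof (is_lim_seq_unique _ _ O2_lim_scaled_sum).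
    pose proof (is_lim_seq_unique _ _ O2_lim_zeta_2).
    congruence. }
  injection E as E0.
  pose proof (scaled_sum_O2 m) as H.
  replace (2 - 2 * scaled_sum 0 + 4 * O2 m) with (4 * O2 m - 3 * zeta 2) in H
    by lra.
  pose proof (double_minus_1_neq_0 m).
  rewrite <- H; field; lra.
Qed.

(** * Unscaling and the special cases m = 0, 1, 2 *)

Lemma binom_pos (n k : nat) : 0 < binom n k.
Proof.
  apply Rdiv_lt_0_compat; repeat apply Rmult_lt_0_compat; apply INR_fact_lt_0.
Qed.

Lemma series_eq (m : nat) :
  is_series_from1
    (fun n : nat =>
       2 ^ (2 * n)
       / (INR n * INR (n + 1) * binom (2 * (n + m)) (n + m)
          * binom (n + m) m))
    (/ binom (2 * m) m
     * ((INR m - 1 / 2) * (4 * O2 m - 3 * zeta 2) + 1)).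
Proof.
  rewrite <- scaled_sum_eq.
  apply is_series_ext with (fun k => / binom (2 * m) m * scaled_term k m).
  - intros k; unfold scaled_term.
    rewrite <- Rmult_assoc, Rinv_l, Rmult_1_l; [reflexivity|].
    apply Rgt_not_eq, binom_pos.
  - apply (is_series_scal_l (/ binom (2 * m) m) (fun k => scaled_term k m)).
    apply Series_correct, ex_series_scaled_term.
Qed.

Lemma binom_0_r (n : nat) : binom n 0 = 1.
Proof.
  unfold binom, Binomial.C; rewrite Nat.sub_0_r; simpl (INR (fact 0)).
  field; apply INR_fact_neq_0.
Qed.

Lemma binom_S_1 (n : nat) : binom (n + 1) 1 = INR (n + 1).
Proof.
  unfold binom, Binomial.C; rewrite Nat.add_sub.
  rewrite Nat.add_1_r, fact_simpl, mult_INR; simpl (INR (fact 1)).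
  field; apply INR_fact_neq_0.
Qed.

Lemma binom_SS_2 (n : nat) : binom (n + 2) 2 = INR (n + 1) * INR (n + 2) / 2.
Proof.
  unfold binom, Binomial.C; rewrite Nat.add_sub.
  replace (n + 2)%nat with (S (S n)) by lia.
  rewrite Nat.add_1_r, 2!fact_simpl, 2!mult_INR; simpl (INR (fact 2)).
  field; apply INR_fact_neq_0.
Qed.

Theorem theorem6 :
  (forall m : nat,
     is_series_from1
       (fun n : nat =>
          2 ^ (2 * n)
          / (INR n * INR (n + 1) * binom (2 * (n + m)) (n + m)
             * binom (n + m) m))
       (/ binom (2 * m) m
        * ((INR m - 1 / 2) * (4 * O2 m - 3 * zeta 2) + 1)))
  /\ is_series_from1
       (fun n : nat =>
          2 ^ (2 * n) / (INR n * INR (n + 1) * binom (2 * n) n))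
       (PI ^ 2 / 4 + 1)
  /\ is_series_from1
       (fun n : nat =>
          2 ^ (2 * n)
          / (INR n * INR (n + 1) ^ 2 * binom (2 * (n + 1)) (n + 1)))
       (3 / 2 - PI ^ 2 / 8)
  /\ is_series_from1
       (fun n : nat =>
          2 ^ (2 * n)
          / (INR n * INR (n + 1) ^ 2 * INR (n + 2)
             * binom (2 * (n + 2)) (n + 2)))
       (23 / 36 - PI ^ 2 / 16).
Proof.
  repeat split.
  - exact series_eq.
  - pose proof (series_eq 0) as H.
    replace (PI ^ 2 / 4 + 1)
      with (/ binom (2 * 0) 0 * ((INR 0 - 1 / 2) * (4 * O2 0 - 3 * zeta 2) + 1)).
    + eapply is_series_ext; [|exact H]; intros k; cbv beta.
      rewrite binom_0_r, Rmult_1_r, Nat.add_0_r; reflexivity.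
    + rewrite binom_0_r, zeta_2, O2_0; simpl (INR 0); field.
  - pose proof (series_eq 1) as H.
    replace (3 / 2 - PI ^ 2 / 8)
      with (/ binom (2 * 1) 1 * ((INR 1 - 1 / 2) * (4 * O2 1 - 3 * zeta 2) + 1)).
    + eapply is_series_ext; [|exact H]; intros k; cbv beta.
      (* The binomial of n + 1 over 1 supplies the second factor n + 1 of the square. *)
      rewrite binom_S_1; f_equal; ring.
    + change (2 * 1)%nat with (1 + 1)%nat; rewrite binom_S_1, zeta_2, O2_S, O2_0; simpl; field.
  - pose proof (series_eq 2) as H.
    (* The binomial of n + 2 over 2 is (n + 1)(n + 2)/2; halving the series absorbs its
       denominator. *)
    apply (is_series_scal_l (/ 2)) in H.
    replace (23 / 36 - PI ^ 2 / 16)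
      with (/ 2 * (/ binom (2 * 2) 2
                   * ((INR 2 - 1 / 2) * (4 * O2 2 - 3 * zeta 2) + 1))).
    + eapply is_series_ext; [|exact H]; intros k; cbv beta.
      rewrite binom_SS_2.
      assert (INR (S k) <> 0) by (apply not_0_INR; lia).
      assert (INR (S k + 1) <> 0) by (apply not_0_INR; lia).
      assert (INR (S k + 2) <> 0) by (apply not_0_INR; lia).
      assert (binom (2 * (S k + 2)) (S k + 2) <> 0) by apply Rgt_not_eq, binom_pos.
      match goal with |- scal ?a ?b = ?c => change (a * b = c :> R) end.
      field; repeat split; assumption.
    + change (2 * 2)%nat with (2 + 2)%nat; rewrite binom_SS_2, zeta_2, !O2_S, O2_0; simpl; field.
Qed.
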